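(* Let $\Lambda$ be a row-finite $2$-graph with no sources, let $H\subseteq\Lambda^0$ be a saturated hereditary set, and let $\Gamma=H\Lambda$. The following are equivalent: (i) The morphism $H_1(j^H):H_1(D^\Gamma_* )\to H_1(D^\Lambda_* )$ is injective. (ii) $\operatorname{im}\partial_2^\Lambda\cap j^H_1(\ker\partial_1^\Gamma)\subseteq j^H_1(\operatorname{im}\partial_2^\Gamma)$. (iii) $$\binom{M^t_{1,H,\Lambda^0\setminus H}}{M^t_{2,H,\Lambda^0\setminus H}}\Big(\ker(M^t_{1,\Lambda^0\setminus H}-1)\cap\ker(M^t_{2,\Lambda^0\setminus H}-1)\Big)\subseteq\binom{M^t_{1,H}-1}{M^t_{2,H}-1}\mathbb{Z}H.$$
   Context: A $2$-graph is a nonempty countable small category $\Lambda$ with a functor $d:\Lambda\to\mathbb{N}^2$ ($0\in\mathbb{N}$) satisfying the factorisation property: if $d(\lambda)=m+n$ there are unique $\mu,\nu\in\Lambda$ with $d(\mu)=m$, $d(\nu)=n$, $\lambda=\mu\nu$. Write $\Lambda^n=d^{-1}(n)$; $\Lambda^0$ (the vertices) is identified with the set of objects; $r(\lambda)$, $s(\lambda)$ are the codomain and domain of $\lambda$; $e_1,e_2$ are the generators of $\mathbb{N}^2$. For $u,v\in\Lambda^0$, $H\subseteq\Lambda^0$: $v\Lambda^n=\{\lambda\in\Lambda^n:r(\lambda)=v\}$, $u\Lambda^nv=\{\lambda\in u\Lambda^n:s(\lambda)=v\}$, $H\Lambda=\{\lambda:r(\lambda)\in H\}$. $\Lambda$ is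 row-finite if every $v\Lambda^n$ is finite, and has no sources if $v\Lambda^{e_i}\neq\emptyset$ for all $v$ and $i$. $H\subseteq\Lambda^0$ is hereditary if $s(H\Lambda)\subseteq H$, and saturated if, for $v\in\Lambda^0$, $\{s(\lambda):\lambda\in v\Lambda^{e_i}\}\subseteq H$ for some $i$ implies $v\in H$. If $H\ne\emptyset$ is hereditary then $H\Lambda$ is a row-finite $2$-graph with no sources and vertex set $H$. For a set $S$, $\mathbb{Z}S$ is the group of finitely supported functions $S\to\mathbb{Z}$, with basis $\{\delta_v:v\in S\}$. For $i=1,2$, $M_{i,\Lambda}(u,v)=|u\Lambda^{e_i}v|$, and $M_{i,\Lambda}^t:\mathbb{Z}\Lambda^0\to\mathbb{Z}\Lambda^0$ is the transpose, $(M_{i,\Lambda}^tf)(v)=\sum_uM_{i,\Lambda}(u,v)f(u)$. Let $\{\epsilon_1,\epsilon_2\}$ be the canonical basis of $\mathbb{Z}^2$. The chain complex $D^\Lambda_*$ has $D^\Lambda_a=\bigwedge^a\mathbb{Z}^2\otimes\mathbb{Z}\Lambda^0$ for $0\le a\le2$ and $D^\Lambda_a=0$ for $a>2$, with differentials $\partial_1^\Lambda(\epsilon_i\otimes\delta_v)=(1-M_{i,\Lambda}^t)\delta_v$ and $\partial^\Lambda_2(\epsilon_1\wedge\epsilon_2\otimes\delta_v)=\epsilon_2\otimes(1-M_{1,\Lambda}^t)\delta_v-\epsilon_1\otimes(1-M_{2,\Lambda}^t)\delta_v$; $D^\Gamma_*$ is defined likewise. The morphism of chain complexes $j^H:D^\Gamma_*\to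 D^\Lambda_*$ is $j^H_a(c\otimes f)=c\otimes i^H(f)$, where $i^H(f)$ is the extension of $f\in\mathbb{Z}H$ to $\Lambda^0$ by zero; $H_1(j^H)$ is the induced map on first homology. Since $H$ is hereditary, $M_{i,\Lambda}(u,v)=0$ for $u\in H$, $v\notin H$, and with respect to $\Lambda^0=H\sqcup(\Lambda^0\setminus H)$ we write $$M^t_{i,\Lambda}=\begin{pmatrix}M^t_{i,H}&M^t_{i,H,\Lambda^0\setminus H}\\0&M^t_{i,\Lambda^0\setminus H}\end{pmatrix}.$$ In (iii) the kernels are taken in $\mathbb{Z}(\Lambda^0\setminus H)$, and both sides are subgroups of $\mathbb{Z}H\oplus\mathbb{Z}H$. *)

(* Defs.v *)
From HB Require Import structures.
From mathcomp Require Import all_boot all_order all_algebra.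
From mathcomp Require Import finmap.
From mathcomp Require Import boolp classical_sets functions cardinality.
From mathcomp Require Import monalg.

Set Implicit Arguments.
Unset Strict Implicit.
Unset Printing Implicit Defensive.

Import GRing.Theory.
Local Open Scope classical_set_scope.
Local Open Scope ring_scope.
Local Open Scope quotient_scope.

(* Since [0.-1 = 0], the field [bd 0] is an endomorphism of [C_0]; requiring it
   to vanish makes it play the role of the map [C_0 -> 0]. *)
Record chain_complex := ChainComplex {
  chain : nat -> zmodType;
  bd : forall a : nat, {additive chain a -> chain a.-1};
  bd0 : forall x, bd 0%N x = 0;
  bd_bd : forall a x, bd a (bd a.+1 x) = 0 }.

Record chain_map (C D : chain_complex) := ChainMap {
  cmap :> forall a : nat, {additive chain C a -> chain D a};
  cmap_bd : forall a x, cmap a.-1 (bd C a x) = bd D a (cmap a x) }.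

Section Homology.
Variables (C : chain_complex) (a : nat).

Definition is_cycle : {pred chain C a} := [pred x | bd C a x == 0].

Fact is_cycle_zmod_closed : zmod_closed is_cycle.
Proof.
split=> [|x y]; rewrite !inE ?raddf0 // => /eqP x0 /eqP y0.
by rewrite raddfB x0 y0 subr0.
Qed.
HB.instance Definition _ :=
  GRing.isZmodClosed.Build (chain C a) is_cycle is_cycle_zmod_closed.

Record cycles := Cycle { cycle_val : chain C a; _ : cycle_val \in is_cycle }.
HB.instance Definition _ := [isSub for cycle_val].
HB.instance Definition _ := [Choice of cycles by <:].
HB.instance Definition _ := [SubChoice_isSubZmodule of cycles by <:].

Definition is_boundary : {pred cycles} :=
  [pred z | `[< range (bd C a.+1) (val z) >]].

Fact is_boundary_zmod_closed : zmod_closed is_boundary.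
Proof.
split=> [|x y]; rewrite ![_ \in is_boundary]/=.
  by apply/asboolP; exists 0 => //; rewrite !raddf0.
move=> /asboolP[u _ ux] /asboolP[v _ vy]; apply/asboolP.
by exists (u - v) => //; rewrite !raddfB ux vy.
Qed.
HB.instance Definition _ :=
  GRing.isZmodClosed.Build cycles is_boundary is_boundary_zmod_closed.

Definition homology := Quotient.quot is_boundary.
HB.instance Definition _ := EqQuotient.on homology.
HB.instance Definition _ := GRing.Zmodule.on homology.

End Homology.

Section HomologyMap.
Variables (C D : chain_complex) (f : chain_map C D) (a : nat).

Fact cycle_map_subproof (z : cycles C a) : f a (val z) \in @is_cycle D a.
Proof.
by case: z => z /=; rewrite !inE -cmap_bd => /eqP ->; rewrite raddf0.
Qed.
Definition cycle_map (z : cycles C a) : cycles D a :=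
  Cycle (cycle_map_subproof z).

Definition homology_map (x : homology C a) : homology D a :=
  \pi_(homology D a) (cycle_map (repr x)).

Lemma homology_mapE (z : cycles C a) :
  homology_map (\pi_(homology C a) z) = \pi_(homology D a) (cycle_map z).
Proof.
rewrite /homology_map; apply/eqP; rewrite -Quotient.idealrBE.
have : repr (\pi_(homology C a) z) - z \in @is_boundary C a.
  by rewrite Quotient.idealrBE reprK.
move=> /asboolP[u _ ux]; apply/asboolP.
exists (f a.+1 u) => //.
have /= <- := @cmap_bd _ _ f a.+1 u.
by rewrite ux !raddfB.
Qed.

Fact homology_map_is_zmod_morphism : zmod_morphism homology_map.
Proof.
elim/quotW => x; elim/quotW => y; rewrite -raddfB /= !homology_mapE -raddfB.
by congr (\pi _); apply: val_inj; rewrite /= !raddfB.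
Qed.
HB.instance Definition _ := GRing.isZmodMorphism.Build
  (homology C a) (homology D a) homology_map homology_map_is_zmod_morphism.

End HomologyMap.
Arguments homology_map {C D} f a x.

(* [hom u v] is uΛv, the set of morphisms with range (codomain) [u] and source
   (domain) [v], so that [comp m n] is the composite written μν.  The index
   [i : 'I_2] (with values 0, 1) stands for i = 1, 2, and ['e_i] for e_i.
   Nonemptiness is not part of the structure: it is a separate hypothesis, so
   that HΛ below makes sense for every hereditary [H], including the empty
   one. *)
Record two_graph := TwoGraph {
  ob : countType;
  hom : ob -> ob -> countType;
  idm : forall u, hom u u;
  comp : forall u v w, hom u v -> hom v w -> hom u w;
  deg : forall u v, hom u v -> 'rV[nat]_2;
  comp1m : forall u v (l : hom u v), comp (idm u) l = l;
  compm1 : forall u v (l : hom u v), comp l (idm v) = l;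
  compA : forall u v w x (l : hom u v) (m : hom v w) (n : hom w x),
    comp l (comp m n) = comp (comp l m) n;
  deg_idm : forall u, deg (idm u) = 0;
  deg_comp : forall u v w (l : hom u v) (m : hom v w),
    deg (comp l m) = deg l + deg m;
  factorisation : forall u w (l : hom u w) (m n : 'rV[nat]_2),
    deg l = m + n ->
    exists! p : {v : ob & (hom u v * hom v w)%type},
      [/\ deg (tagged p).1 = m, deg (tagged p).2 = n
        & comp (tagged p).1 (tagged p).2 = l] }.

Section TwoGraph.
Variable L : two_graph.
Implicit Types (u v w : ob L) (n : 'rV[nat]_2) (i : 'I_2) (H : set (ob L)).

(* vΛ^n; the source of [l : paths v n] is [tag l]. *)
Definition paths v n : set {w : ob L & hom v w} :=
  [set l | deg (tagged l) = n].
Arguments paths v n : clear implicits.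

Definition row_finite := forall v n, finite_set (paths v n).

Definition no_sources := forall v i, paths v 'e_i !=set0.

Definition hereditary H := forall u v (l : hom u v), H u -> H v.

Definition saturated H :=
  forall v i, [set tag l | l in paths v 'e_i] `<=` H -> H v.

(* The vertex matrices M_i; a junk value is returned on infinite sets. *)
Definition vmx i u v : nat :=
  #|` fset_set [set l : hom u v | deg l = 'e_i] |.

End TwoGraph.
Arguments paths {L} v n.
Arguments row_finite : clear implicits.
Arguments no_sources : clear implicits.

(* HΛ.  As [H] is hereditary, a morphism with range in [H] has its source in
   [H] too, so these are exactly the morphisms between vertices of [H]. *)
Section Restriction.
Variables (L : two_graph) (H : set (ob L)) (hH : hereditary H).

Fact restr_factorisation (u w : H) (l : hom (val u) (val w))
    (m n : 'rV[nat]_2) : deg l = m + n ->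
  exists! p : {v : H & (hom (val u) (val v) * hom (val v) (val w))%type},
    [/\ deg (tagged p).1 = m, deg (tagged p).2 = n
      & comp (tagged p).1 (tagged p).2 = l].
Proof.
move=> /(@factorisation L)[[v [l1 l2]] [/= pP pU]].
have Hv : v \in H := mem_set (hH l1 (set_mem (valP u))).
exists (existT _ (exist _ v Hv : H) (l1, l2)); split=> //.
move=> [[v' Hv'] [l1' l2']] /= /(pU (existT _ v' (l1', l2'))).
move=> /esym E.
have Ev : v' = v := congr1 tag E.
move: Hv' l1' l2' E; rewrite Ev {v' Ev} => Hv' l1' l2' E.
rewrite (bool_irrelevance Hv' Hv).
by rewrite (eq_from_Tagged E).
Qed.

Definition restr : two_graph := @TwoGraph H
  (fun u v => hom (val u) (val v))
  (fun u => idm (val u))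
  (fun u v w l m => comp l m)
  (fun u v l => deg l)
  (fun u v l => comp1m l)
  (fun u v l => compm1 l)
  (fun u v w x l m n => compA l m n)
  (fun u => deg_idm (val u))
  (fun u v w l m => deg_comp l m)
  restr_factorisation.

Definition restr_path (v : H) (l : {w : H & hom (val v) (val w)}) :
  {w : ob L & hom (val v) w} := Tagged (hom (val v)) (tagged l).

Lemma restr_path_inj v : injective (@restr_path v).
Proof.
move=> [[w Hw] l] [[w' Hw'] l'] E.
have Ew : w = w' := congr1 tag E.
move: Hw l E; rewrite Ew {w Ew} => Hw l E.
rewrite (bool_irrelevance Hw Hw') in l E *.
by have /= -> : l = l' := eq_from_Tagged E.
Qed.

Lemma row_finite_restr : row_finite L -> row_finite restr.
Proof.
move=> rfL v n; rewrite -(eq_finite_set (inj_card_eq (in2W (@restr_path_inj v)))).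
by apply: sub_finite_set (rfL (val v) n) => _ [l ln <-].
Qed.

End Restriction.
Arguments row_finite_restr {L H} hH _.

Fact subr_subAC (V : zmodType) (a b c d : V) :
  a - b - (c - d) = a - c - (b - d).
Proof. by rewrite !opprB [d - c]addrC [d - b]addrC addrACA. Qed.

(* ℤS is [{malg int[S]}], and δ_v is [<< v >>]. *)
Section LinearExtension.
Variables (K : choiceType) (W : zmodType) (g : K -> W).

(* The additive map with δ_k ↦ g k. *)
Definition linext (f : {malg int[K]}) : W := \sum_(k <- msupp f) g k *~ f@_k.

Lemma linextEw (f : {malg int[K]}) (S : {fset K}) :
  (msupp f `<=` S)%fset -> linext f = \sum_(k <- S) g k *~ f@_k.
Proof.
move=> fS; apply: (big_fset_incl _ fS) => k _ /mcoeff_outdom ->.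
by rewrite mulr0z.
Qed.

Fact linext_is_zmod_morphism : zmod_morphism linext.
Proof.
move=> f1 f2; pose S := (msupp f1 `|` msupp f2)%fset.
rewrite (@linextEw f1 S) ?fsubsetUl // (@linextEw f2 S) ?fsubsetUr //.
rewrite (@linextEw _ S) ?msuppB_le // -sumrB.
by apply: eq_bigr => k _; rewrite mcoeffB mulrzBr.
Qed.
HB.instance Definition _ :=
  GRing.isZmodMorphism.Build {malg int[K]} W linext linext_is_zmod_morphism.

Lemma linextU (k : K) : linext << k >> = g k.
Proof.
rewrite (linextEw msuppU_le) big_seq_fset1 mcoeffUU.
by rewrite mulr1z.
Qed.

End LinearExtension.

Lemma malg_eq (K : choiceType) (W : zmodType)
    (p q : {additive {malg int[K]} -> W}) :
  (forall k, p << k >> = q << k >>) -> p =1 q.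
Proof.
move=> pq f; rewrite [f]monalgE !raddf_sum; apply: eq_bigr => k _.
have -> : << f@_k *g k >> = << k >> *~ f@_k.
  apply/malgP => k'; rewrite raddfMz /= !mcoeffU.
  by case: eqP; rewrite ?mulr1n ?mulr0n ?mul0rz // mulrzz mul1r.
by rewrite !raddfMz pq.
Qed.

Lemma linext_coeff (K K' : choiceType) (g : K -> {malg int[K']})
    (f : {malg int[K]}) (v : K') :
  (linext g f)@_v = \sum_(k <- msupp f) (g k)@_v * f@_k.
Proof.
by rewrite raddf_sum; apply: eq_bigr => k _; rewrite /= raddfMz /= mulrzz.
Qed.

Lemma sum_msupp1 (K : choiceType) (f : {malg int[K]}) (k0 : K) :
  \sum_(k <- msupp f) (k == k0)%:R * f@_k = f@_k0.
Proof.
have [k0f|k0f] := boolP (k0 \in msupp f).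
  rewrite (big_fsetD1 k0) //= eqxx mul1r big1_fset ?addr0 // => k.
  by rewrite in_fsetD1 => /andP[/negPf -> _]; rewrite mul0r.
rewrite (mcoeff_outdom k0f) big1_fset // => k kf _.
by case: eqP kf k0f => [-> ->|]; rewrite // mul0r.
Qed.

Section Extension.
Variables (V : choiceType) (A : set V).

(* Extension by zero ℤA → ℤV and restriction ℤV → ℤA. *)
Definition extz : {malg int[A]} -> {malg int[V]} :=
  linext (fun x : A => << val x >>).
HB.instance Definition _ := GRing.Additive.on extz.

Definition restrz : {malg int[V]} -> {malg int[A]} :=
  linext (fun v => if insub v is Some x then << x >> else 0).
HB.instance Definition _ := GRing.Additive.on restrz.

Lemma extzE (f : {malg int[A]}) (v : V) :
  (extz f)@_v = if insub v is Some x then f@_x else 0.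
Proof.
rewrite linext_coeff; case: insubP => [x _ <-|vA].
  rewrite -[RHS]sum_msupp1; apply: eq_bigr => k _.
  by rewrite mcoeffU (inj_eq val_inj).
rewrite big1_fset // => k _ _; rewrite mcoeffU.
case: eqP => [E|_]; last by rewrite mulr0n mul0r.
by move: vA; rewrite -E (valP k).
Qed.

Lemma restrzE (f : {malg int[V]}) (x : A) : (restrz f)@_x = f@_(val x).
Proof.
rewrite linext_coeff -[RHS]sum_msupp1; apply: eq_bigr => k _; congr (_ * _).
case: insubP => [y _ <-|kA]; first by rewrite mcoeffU (inj_eq val_inj).
rewrite mcoeff0; case: eqP => // E.
by move: kA; rewrite E (valP x).
Qed.

End Extension.
Arguments restrz {V} A f.

Section Transpose.
Variable L : two_graph.
Implicit Types (u v w : ob L) (i : 'I_2).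

(* M_i^t, as the additive map δ_u ↦ Σ_v M_i(u,v) δ_v; see [tvmxE]. *)
Definition tvmx i : {malg int[ob L]} -> {malg int[ob L]} :=
  linext (fun u => \sum_(v <- fset_set [set tag l | l in paths u 'e_i])
                     << (vmx i u v)%:Z *g v >>).
HB.instance Definition _ i := GRing.Additive.on (tvmx i).

Definition one_sub_tvmx i (f : {malg int[ob L]}) : {malg int[ob L]} :=
  f - tvmx i f.

Fact one_sub_tvmx_is_zmod_morphism i : zmod_morphism (one_sub_tvmx i).
Proof.
by move=> f g; rewrite /one_sub_tvmx raddfB opprD addrACA -opprD.
Qed.
HB.instance Definition _ i :=
  GRing.isZmodMorphism.Build {malg int[ob L]} {malg int[ob L]}
    (one_sub_tvmx i) (one_sub_tvmx_is_zmod_morphism i).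

Hypothesis rfL : row_finite L.

Lemma mem_fset_paths v n (l : {w : ob L & hom v w}) :
  (l \in fset_set (paths v n)) = (deg (tagged l) == n).
Proof.
rewrite in_fset_set; last exact: rfL.
by apply/idP/eqP => [/set_mem|le]; last exact: mem_set.
Qed.

Lemma tvmxU_coeff i u v : (tvmx i << u >>)@_v = (vmx i u v)%:Z.
Proof.
rewrite /tvmx linextU raddf_sum /=.
set S := fset_set _; have finS : finite_set [set tag l | l in paths u 'e_i].
  exact/finite_image/rfL.
have [vS|vS] := boolP (v \in S).
  rewrite (big_fsetD1 v) //= mcoeffUU big1_fset ?addr0 // => w.
  by rewrite in_fsetD1 mcoeffU => /andP[/negPf ->].
rewrite big1_fset => [|w wS _].
  rewrite /vmx (_ : [set _ | _] = set0) ?fset_set0 ?cardfs0 //.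
  apply/seteqP; split=> // l /= le; move: vS; rewrite in_fset_set // => /negP.
  by case; apply/mem_set; exists (existT _ v l).
rewrite mcoeffU; case: eqP wS vS => [->|//] wS /negP; by [].
Qed.

Lemma tvmxE i (f : {malg int[ob L]}) v :
  (tvmx i f)@_v = \sum_(u <- msupp f) (vmx i u v)%:Z * f@_u.
Proof.
rewrite linext_coeff; apply: eq_bigr => u _; congr (_ * _).
by rewrite -tvmxU_coeff /tvmx linextU.
Qed.

Lemma tvmxU i u :
  tvmx i << u >> = \sum_(l <- fset_set (paths u 'e_i)) << tag l >>.
Proof.
apply/malgP => v; rewrite tvmxU_coeff raddf_sum /=.
under eq_bigr do rewrite mcoeffU.
rewrite -[LHS]natz -natr_sum; congr (_ %:R).
transitivity (count (fun l => tag l == v) (fset_set (paths u 'e_i))); last first.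
  by rewrite -sum1_count big_mkcond; apply: eq_bigr => l _; case: eqP.
rewrite -size_filter /vmx.
rewrite -(size_map (fun l : hom u v => Tagged (hom u) l)).
apply: perm_size; apply: uniq_perm.
- by rewrite map_inj_uniq ?fset_uniq // => l l'; apply: eq_from_Tagged.
- exact/filter_uniq/fset_uniq.
have fin_hom : finite_set [set l : hom u v | deg l = 'e_i].
  have Tinj : injective (fun l : hom u v => Tagged (hom u) l).
    by move=> l l'; apply: eq_from_Tagged.
  rewrite -(eq_finite_set (inj_card_eq (in2W Tinj))).
  by apply: sub_finite_set (rfL u 'e_i) => _ [l le <-].
move=> k; rewrite mem_filter; apply/mapP/andP => [[m]|[]].
  rewrite in_fset_set // => /set_mem me ->; split; first exact/eqP.
  by rewrite mem_fset_paths; apply/eqP.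
case: k => w l /eqP/= wv; rewrite mem_fset_paths => /eqP; subst w => le.
by exists l => //; rewrite in_fset_set //; apply/mem_set.
Qed.

Lemma tvmx2U i j u : tvmx j (tvmx i << u >>) =
  \sum_(l <- fset_set (paths u ('e_i + 'e_j))) << tag l >>.
Proof.
rewrite tvmxU raddf_sum /=; under eq_bigr do rewrite tvmxU.
pose f (l : {v & hom u v}) (m : {w & hom (tag l) w}) : {w & hom u w} :=
  Tagged (hom u) (comp (tagged l) (tagged m)).
transitivity (\sum_(k <- [seq f l m | l <- fset_set (paths u 'e_i),
                               m <- fset_set (paths (tag l) 'e_j)])
                    (<< tag k >> : {malg int[ob L]})).
  by rewrite big_allpairs_dep.
apply: perm_big; apply: uniq_perm; [|exact: fset_uniq|].
  apply: allpairs_uniq_dep => [|l _|]; try exact: fset_uniq.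
  have memP (p : {l : {v & hom u v} & {w & hom (tag l) w}}) :
      p \in [seq Tagged (fun l => {w & hom (tag l) w}) m
              | l <- fset_set (paths u 'e_i), m <- fset_set (paths (tag l) 'e_j)] ->
      deg (tagged (tag p)) = 'e_i /\ deg (tagged (tagged p)) = 'e_j.
    move=> /allpairsPdep[l [m [le me ->]]] /=.
    by move: le me; rewrite !mem_fset_paths => /eqP + /eqP.
  move=> p p' /memP + /memP; case: p p' => [[v l] [w m]] [[v' l'] [w' m']].
  rewrite /= => -[le me] [le' me'] E.
  have Ew : w = w' := congr1 tag E.
  subst w'; move: (eq_from_Tagged E) => /= {}E.
  have : deg (comp l m) = 'e_i + 'e_j by rewrite deg_comp le me.
  move=> /factorisation[q [_ qU]].
  have := qU (existT _ v (l, m)) (And3 le me erefl).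
  have -> := qU (existT _ v' (l', m')) (And3 le' me' (esym E)).
  move=> F; have Ev : v' = v := congr1 tag F.
  by subst v'; case: (eq_from_Tagged F) => -> ->.
move=> [w k]; rewrite mem_fset_paths; apply/allpairsPdep/eqP => /=.
  move=> [l [m [+ + /(congr1 (fun z => deg (tagged z)))/= ->]]].
  by rewrite !mem_fset_paths deg_comp => /eqP -> /eqP ->.
move=> /factorisation[[v [l m]] [/= [le me <-] _]].
exists (existT _ v l), (existT _ w m).
by split; rewrite // mem_fset_paths; apply/eqP.
Qed.

Lemma tvmxC i j f : tvmx i (tvmx j f) = tvmx j (tvmx i f).
Proof.
apply: (@malg_eq _ _ (tvmx i \o tvmx j) (tvmx j \o tvmx i) _ f) => u /=.
by rewrite !tvmx2U addrC.
Qed.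

Lemma one_sub_tvmxC i j f :
  one_sub_tvmx i (one_sub_tvmx j f) = one_sub_tvmx j (one_sub_tvmx i f).
Proof.
have tB k g h : tvmx k (g - h) = tvmx k g - tvmx k h by apply: raddfB.
rewrite /one_sub_tvmx 2!tB (tvmxC i j).
exact: subr_subAC.
Qed.

End Transpose.

(* The exterior power ⋀^a ℤ^2 is the free abelian group on the a-element subsets
   I of the index set, the subset {i_1 < ... < i_a} standing for
   ϵ_{i_1} ∧ ... ∧ ϵ_{i_a}.  Hence ⋀^a ℤ^2 ⊗ ℤV consists of the families of
   elements of ℤV indexed by these subsets; it vanishes for a > 2. *)
Definition wedge_basis (a : nat) := {I : {set 'I_2} | #|I| == a}.

Definition wedge (a : nat) := {ffun wedge_basis a -> int}.

Definition wedge_tensor (a : nat) (V : choiceType) :=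
  {ffun wedge_basis a -> {malg int[V]}}.
HB.instance Definition _ a V := GRing.Zmodule.on (wedge_tensor a V).

Definition tensor a (V : choiceType) (c : wedge a) (f : {malg int[V]}) :
  wedge_tensor a V := [ffun I => f *~ c I].

Fact ind0_subproof : #|(@finset.set0 'I_2)| == 0%N.
Proof. by rewrite cards0. Qed.
Definition ind0 : wedge_basis 0%N := exist _ (@finset.set0 'I_2) ind0_subproof.

Fact ind1_subproof (i : 'I_2) : #|[set i]%SET| == 1%N.
Proof. by rewrite cards1. Qed.
Definition ind1 (i : 'I_2) : wedge_basis 1%N := exist _ [set i]%SET (ind1_subproof i).

Fact ind2_subproof : #|[set: 'I_2]%SET| == 2%N.
Proof. by rewrite cardsT card_ord. Qed.
Definition ind2 : wedge_basis 2%N := exist _ [set: 'I_2]%SET ind2_subproof.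

(* The basis vector of ⋀^a ℤ^2 indexed by I: thus [eps ind0] is 1, [eps (ind1 i)]
   is ϵ_i and [eps ind2] is ϵ_1 ∧ ϵ_2. *)
Definition eps a (I : wedge_basis a) : wedge a := [ffun J => (J == I)%:R].

Lemma wedge_tensorB a (V : choiceType) (x y : wedge_tensor a V) I :
  (x - y) I = x I - y I.
Proof. by rewrite !ffunE. Qed.

Lemma tensor_eps a (V : choiceType) (I J : wedge_basis a) (f : {malg int[V]}) :
  tensor (eps I) f J = if J == I then f else 0.
Proof. by rewrite !ffunE; case: eqP; rewrite ?mulr1z ?mulr0z. Qed.

Lemma tensorB a (V : choiceType) (c : wedge a) (f g : {malg int[V]}) :
  tensor c (f - g) = tensor c f - tensor c g.
Proof. by apply/ffunP => I; rewrite !ffunE mulrzBl. Qed.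

Lemma ind1_inj : injective ind1.
Proof. by move=> i j /(congr1 val)/= /set1_inj. Qed.

Section DComplex.
Variable L : two_graph.
Let D (a : nat) := wedge_tensor a (ob L).

Definition D_bd1 (x : D 1%N) : D 0%N :=
  tensor (eps ind0) (\sum_i one_sub_tvmx i (x (ind1 i))).

Definition D_bd2 (y : D 2%N) : D 1%N :=
  tensor (eps (ind1 1)) (one_sub_tvmx 0 (y ind2))
  - tensor (eps (ind1 0)) (one_sub_tvmx 1 (y ind2)).

Definition D_bd a : D a -> D a.-1 :=
  match a with 1%N => D_bd1 | 2%N => D_bd2 | _ => fun=> 0 end.

Fact one_sub_tvmxB i (f g : {malg int[ob L]}) :
  one_sub_tvmx i (f - g) = one_sub_tvmx i f - one_sub_tvmx i g.
Proof. exact: raddfB. Qed.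

Fact D_bd1_is_zmod_morphism : zmod_morphism D_bd1.
Proof.
move=> x y; rewrite /D_bd1 -tensorB -sumrB; congr tensor.
by apply: eq_bigr => i _; rewrite -one_sub_tvmxB !ffunE.
Qed.

Fact D_bd2_is_zmod_morphism : zmod_morphism D_bd2.
Proof.
move=> x y; rewrite /D_bd2.
have -> : (x - y) ind2 = x ind2 - y ind2 by rewrite !ffunE.
rewrite (one_sub_tvmxB 0) (one_sub_tvmxB 1).
rewrite (tensorB (eps (ind1 0))) (tensorB (eps (ind1 1))).
exact: subr_subAC.
Qed.

Fact D_bd_is_zmod_morphism a : zmod_morphism (@D_bd a).
Proof.
case: a => [|[|[|a]]].
- by move=> x y; rewrite /= subr0.
- exact: D_bd1_is_zmod_morphism.
- exact: D_bd2_is_zmod_morphism.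
- by move=> x y; rewrite /= subr0.
Qed.
HB.instance Definition _ a :=
  GRing.isZmodMorphism.Build (D a) (D a.-1) (@D_bd a) (@D_bd_is_zmod_morphism a).

Lemma D_bd1_eps i v :
  D_bd1 (tensor (eps (ind1 i)) << v >>)
  = tensor (eps ind0) (one_sub_tvmx i << v >>).
Proof.
congr tensor; rewrite (bigD1 i) //= tensor_eps eqxx big1 ?addr0 // => k ki.
by rewrite tensor_eps (inj_eq ind1_inj) (negPf ki) raddf0.
Qed.

Lemma D_bd2_eps v :
  D_bd2 (tensor (eps ind2) << v >>)
  = tensor (eps (ind1 1)) (one_sub_tvmx 0 << v >>)
    - tensor (eps (ind1 0)) (one_sub_tvmx 1 << v >>).
Proof. by rewrite /D_bd2 tensor_eps eqxx. Qed.

Lemma D_bd2E y I : D_bd2 y I =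
  (if I == ind1 1 then one_sub_tvmx 0 (y ind2) else 0)
  - (if I == ind1 0 then one_sub_tvmx 1 (y ind2) else 0).
Proof. by rewrite /D_bd2 wedge_tensorB; congr (_ - _); apply: tensor_eps. Qed.

Lemma D_bd2E0 y : D_bd2 y (ind1 0) = - one_sub_tvmx 1 (y ind2).
Proof. by rewrite D_bd2E !(inj_eq ind1_inj) /= sub0r. Qed.

Lemma D_bd2E1 y : D_bd2 y (ind1 1) = one_sub_tvmx 0 (y ind2).
Proof. by rewrite D_bd2E !(inj_eq ind1_inj) /= subr0. Qed.

Hypothesis rfL : row_finite L.

Lemma D_bd1_bd2 y : D_bd1 (D_bd2 y) = 0.
Proof.
apply/ffunP => I; rewrite /D_bd1 big_ord_recl big_ord1.
rewrite (_ : lift ord0 ord0 = 1) //; last exact/val_inj.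
rewrite D_bd2E0 D_bd2E1 (one_sub_tvmxC rfL 1 0).
rewrite (_ : one_sub_tvmx 0 (- _) = - one_sub_tvmx 0 (one_sub_tvmx 1 (y ind2))).
  by rewrite addNr !ffunE mul0rz.
exact: raddfN.
Qed.

Lemma D_bd_bd a (x : D a.+1) : D_bd (D_bd x) = 0.
Proof.
case: a x => [|[|a]] x; [by []|exact: D_bd1_bd2|].
exact: (raddf0 (@D_bd a.+2)).
Qed.

Definition D_complex : chain_complex :=
  @ChainComplex D (fun a => @D_bd a) (fun=> erefl) D_bd_bd.

End DComplex.

Section Inclusion.
Variables (L : two_graph) (rfL : row_finite L).
Variables (H : set (ob L)) (hH : hereditary H).

(* ℤH → ℤΛ^0, where H is the vertex set of Γ = HΛ *)
Definition incl : {malg int[ob (restr hH)]} -> {malg int[ob L]} := @extz _ H.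
HB.instance Definition _ := GRing.Additive.on incl.

Definition j_fun a (x : wedge_tensor a (ob (restr hH))) :
  wedge_tensor a (ob L) := [ffun I => incl (x I)].

Fact j_fun_is_zmod_morphism a : zmod_morphism (@j_fun a).
Proof. by move=> x y; apply/ffunP => I; rewrite !ffunE raddfB. Qed.
HB.instance Definition _ a :=
  GRing.isZmodMorphism.Build (wedge_tensor a (ob (restr hH)))
    (wedge_tensor a (ob L)) (@j_fun a) (@j_fun_is_zmod_morphism a).

Lemma j_fun_tensor a (c : wedge a) f : j_fun (tensor c f) = tensor c (incl f).
Proof. by apply/ffunP => I; rewrite !ffunE raddfMz. Qed.

Lemma incl_tvmx i f : incl (tvmx i f) = tvmx i (incl f).
Proof.
apply: (@malg_eq _ _ (incl \o tvmx i) (tvmx i \o incl) _ f) => u /=.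
rewrite (tvmxU (row_finite_restr hH rfL)) raddf_sum /=.
rewrite /incl /extz linextU (tvmxU rfL).
under eq_bigr do rewrite linextU.
rewrite -(big_map (@restr_path _ _ u) xpredT
  (fun l => << tag l >> : {malg int[ob L]})).
apply: perm_big; apply: uniq_perm; last 1 first.
- move=> k; rewrite (mem_fset_paths rfL); apply/mapP/eqP => [[l]|].
    by rewrite (mem_fset_paths (row_finite_restr hH rfL)) => /eqP le ->.
  case: k => w l /= le.
  have Hw : w \in H := mem_set (hH l (set_mem (valP u))).
  exists (existT _ (exist _ w Hw : H) l) => //.
  by rewrite (mem_fset_paths (row_finite_restr hH rfL)); apply/eqP.
- by rewrite map_inj_uniq ?fset_uniq //; apply: restr_path_inj.
- exact: fset_uniq.
Qed.

Lemma incl_one_sub_tvmx i f :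
  incl (one_sub_tvmx i f) = one_sub_tvmx i (incl f).
Proof. by rewrite /one_sub_tvmx raddfB /= incl_tvmx. Qed.

Lemma j_funE a (x : wedge_tensor a (ob (restr hH))) I :
  j_fun x I = incl (x I).
Proof. exact: ffunE. Qed.

Lemma j_fun_bd a x : j_fun (D_bd x) = D_bd (j_fun x) :> wedge_tensor a.-1 _.
Proof.
have jB b x1 x2 : @j_fun b (x1 - x2) = j_fun x1 - j_fun x2 by exact: raddfB.
case: a x => [|[|[|a]]] x; [exact: raddf0| | |exact: raddf0].
- rewrite /= /D_bd1 j_fun_tensor raddf_sum; congr tensor.
  by apply: eq_bigr => i _; rewrite j_funE -incl_one_sub_tvmx.
- rewrite /= /D_bd2 (jB 1%N); congr (_ - _).
    by rewrite (j_fun_tensor (eps (ind1 1))) incl_one_sub_tvmx -j_funE.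
  by rewrite (j_fun_tensor (eps (ind1 0))) incl_one_sub_tvmx -j_funE.
Qed.

Definition j_map :
    chain_map (D_complex (row_finite_restr hH rfL)) (D_complex rfL) :=
  @ChainMap (D_complex (row_finite_restr hH rfL)) (D_complex rfL)
    (fun a => @j_fun a) j_fun_bd.

End Inclusion.

(* The block of M_i^t with columns indexed by [A] and rows indexed by [B], as a
   map ℤA → ℤB. *)
Definition tvmx_block (L : two_graph) (i : 'I_2) (A B : set (ob L))
    (f : {malg int[A]}) : {malg int[B]} :=
  restrz B (tvmx i (extz f)).
Arguments tvmx_block {L} i A B f.

Lemma tvmx_blockE (L : two_graph) (rfL : row_finite L) i (A B : set (ob L))
    (f : {malg int[A]}) (x : B) :
  (tvmx_block i A B f)@_x
  = \sum_(u <- msupp f) (vmx i (val u) (val x))%:Z * f@_u.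
Proof.
rewrite restrzE /extz {1}/linext (raddf_sum (tvmx i)) (raddf_sum (mcoeff _)).
apply: eq_bigr => u _; rewrite (raddfMz (tvmx i)) (raddfMz (mcoeff _)) mulrzz.
by congr (_ * _); apply: tvmxU_coeff.
Qed.

(* Main.v *)
Require Import Defs.
From HB Require Import structures.
From mathcomp Require Import all_boot all_order all_algebra.
From mathcomp Require Import finmap.
From mathcomp Require Import boolp classical_sets functions cardinality.
From mathcomp Require Import monalg.

Set Implicit Arguments.
Unset Strict Implicit.
Unset Printing Implicit Defensive.

Import GRing.Theory.
Local Open Scope classical_set_scope.
Local Open Scope ring_scope.

(** For a chain map that is injective in degree [a], the kernel of the map on
    [a]-th homology is [(im bd ∩ f (ker bd)) / f (im bd)], so that
    injectivity on homology amounts to (ii).  For the rest, an element of the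
    degree 2 part of the complex of Λ is a single [h] in ℤΛ^0, and its boundary
    has, up to signs, the two coordinates [h - M_i^t h].  As [j] is injective
    in degree 0, any [x] with [j x] a boundary is a cycle, and (ii) becomes the
    following condition, [boundary_lifting]: if both [h - M_i^t h] are supported
    in [H], then some [g] in ℤH has the same boundary as [h].

    Split [h] as [g0 + f] with [g0] in ℤH and [f] in ℤ(Λ^0 \ H).  As [H] is
    hereditary, M_i^t maps ℤH to itself, so the component of [h - M_i^t h]
    outside [H] depends on [f] only: it vanishes for both i exactly when [f]
    lies in the two kernels of (iii).  For such an [f],
    [f - M_i^t f = - M_{i,H,Λ^0\H}^t f] ([one_sub_tvmx_extz_setC]), and this is
    [(1 - M_{i,H}^t) g], for both i with a common [g], exactly when (iii) holds
    at [f].  Adding [g0] to [g] passes from [f] to [h]. *)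

(** * Injectivity on homology *)

Lemma homology_pi_eq0 (C : chain_complex) a (z : cycles C a) :
  \pi_(homology C a)%qT z = 0 <-> range (bd C a.+1) (val z).
Proof.
have -> : (0 : homology C a) = \pi_(homology C a)%qT 0 by rewrite raddf0.
split=> [/eqP|bz]; first by rewrite -Quotient.idealrBE subr0 => /asboolP.
by apply/eqP; rewrite -Quotient.idealrBE subr0; apply/asboolP.
Qed.

(** The kernel on homology consists of the classes of cycles [x] with [f x] a
    boundary; injectivity of [f] in degree [a] turns [x] in [im bd] into [f x] in
    [f (im bd)]. *)
Lemma homology_map_injP (C D : chain_complex) (f : chain_map C D) a :
  injective (f a) ->
  injective (homology_map f a) <->
  range (bd D a.+1) `&` (f a @` [set x | bd C a x = 0])
    `<=` f a @` range (bd C a.+1).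
Proof.
move=> f_inj; split=> [Hf_inj y [by_ [x x0 xy]]|sub].
  have xC : x \in @is_cycle C a by rewrite inE; apply/eqP.
  exists x => //; apply/(homology_pi_eq0 (Cycle xC)).
  apply: Hf_inj; rewrite raddf0 homology_mapE.
  by apply/homology_pi_eq0; rewrite /= xy.
apply: raddf_inj; elim/quotW => z; rewrite /= homology_mapE.
move=> /homology_pi_eq0 bz; apply/homology_pi_eq0.
have /sub[x bx /f_inj <- //] : (range (bd D a.+1) `&`
    (f a @` [set x | bd C a x = 0])) (f a (val z)).
  by split=> //; exists (val z) => //; apply/eqP; case: (z).
Qed.

(** * Extension by zero and restriction *)

Section Support.
Variables (V : choiceType) (A : set V).

Lemma extzK : cancel (@extz V A) (restrz A).
Proof. by move=> f; apply/malgP => x; rewrite restrzE extzE valK. Qed.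

Lemma restrz_extz_setC (f : {malg int[A]}) : restrz (~` A) (extz f) = 0.
Proof.
apply/malgP => x; rewrite restrzE extzE mcoeff0 insubN //.
by apply/negP => /set_mem; apply: (set_mem (valP x)).
Qed.

Lemma extz_restrzD (f : {malg int[V]}) :
  f = extz (restrz A f) + extz (restrz (~` A) f).
Proof.
apply/malgP => v; rewrite mcoeffD !extzE.
have [vA|vA] := boolP (v \in A).
  rewrite insubT insubN ?addr0 ?restrzE //.
  by apply/negP => /set_mem; apply; apply: set_mem.
have vK : v \in ~` A by apply/mem_set => vA'; move: vA; rewrite mem_set.
by rewrite insubN // insubT add0r restrzE.
Qed.

End Support.

(** * Coordinates of the boundaries *)

Lemma ord2P (i : 'I_2) : i = 0 \/ i = 1.
Proof. by case: i => -[|[|//]] Hi; [left|right]; apply: val_inj. Qed.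

Lemma wedge_tensor1P (V : choiceType) (x y : wedge_tensor 1 V) :
  x = y <-> x (ind1 0) = y (ind1 0) /\ x (ind1 1) = y (ind1 1).
Proof.
split=> [->//|[E0 E1]]; apply/ffunP => -[I cI].
have /cards1P[i Ii] := cI; have -> : exist _ I cI = ind1 i by apply: val_inj.
by have [->|->] := ord2P i.
Qed.

Lemma D_bd2_coordP (L : two_graph) (y : wedge_tensor 2 (ob L)) x :
  D_bd2 y = x <->
  - one_sub_tvmx 1 (y ind2) = x (ind1 0) /\ one_sub_tvmx 0 (y ind2) = x (ind1 1).
Proof.
split=> [<-|[E0 E1]]; first by split; [rewrite D_bd2E0|rewrite D_bd2E1].
by apply/wedge_tensor1P; split; [rewrite D_bd2E0|rewrite D_bd2E1].
Qed.

Lemma D_bd2_eqP (L : two_graph) (y y' : wedge_tensor 2 (ob L)) :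
  D_bd2 y = D_bd2 y' <->
  forall i, one_sub_tvmx i (y ind2) = one_sub_tvmx i (y' ind2).
Proof.
split=> [/D_bd2_coordP[]|E].
  rewrite D_bd2E0 D_bd2E1 => /oppr_inj E1 E0 i.
  by have [->|->] := ord2P i; [exact: E0|exact: E1].
apply/D_bd2_coordP; rewrite (E 0) (E 1).
by split; [rewrite D_bd2E0|rewrite D_bd2E1].
Qed.

(** * Block form of the boundaries *)

Section Blocks.
Variables (L : two_graph) (rfL : row_finite L).
Variables (H : set (ob L)) (hH : hereditary H).
Local Notation K := (~` H).
Local Notation incl := (@Defs.incl L H hH).

Lemma incl_inj : injective incl.
Proof. exact: can_inj (@extzK _ H). Qed.

Lemma restrz_incl g : restrz K (incl g) = 0.
Proof. exact: restrz_extz_setC. Qed.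

Lemma j_fun_inj a : injective (@j_fun L H hH a).
Proof.
move=> x y E; apply/ffunP => I.
by apply: incl_inj; rewrite -!j_funE E.
Qed.

(** Heredity is what makes the diagonal block the vertex matrix of HΛ. *)
Lemma tvmx_block_restr i (g : {malg int[H]}) :
  tvmx_block i H H g = @tvmx (restr hH) i g.
Proof.
rewrite /tvmx_block -[extz g]/(incl g) -(incl_tvmx rfL).
exact: extzK.
Qed.

Lemma one_sub_tvmx_extz_setC i (f : {malg int[K]}) :
  one_sub_tvmx i (extz f)
  = extz (f - tvmx_block i K K f) - incl (tvmx_block i K H f).
Proof.
rewrite /one_sub_tvmx {1}[tvmx i (extz f)](extz_restrzD H) opprD addrCA.
by rewrite addrC [in RHS]raddfB.
Qed.

(** As M_i^t maps ℤH to itself, the component of [h - M_i^t h] outside [H]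
    does not see the part of [h] in ℤH; it is [1 - M_i^t] on the complement. *)
Lemma range_incl_one_sub_tvmx i (h : {malg int[ob L]}) :
  range incl (one_sub_tvmx i h) <->
  tvmx_block i K K (restrz K h) - restrz K h = 0.
Proof.
set f := restrz K h; set g0 := restrz H h.
have -> : h = incl g0 + extz f := extz_restrzD H h.
rewrite [one_sub_tvmx i _]raddfD /= -(incl_one_sub_tvmx rfL).
rewrite one_sub_tvmx_extz_setC; split=> [[x _ /(congr1 (restrz K))]|f0].
  rewrite 2!(raddfD (restrz K)) (raddfN (restrz K)) /= !restrz_incl extzK.
  rewrite subr0 add0r => /esym/eqP; rewrite subr_eq0 => /eqP <-.
  exact: subrr.
exists (@one_sub_tvmx (restr hH) i g0 - tvmx_block i K H f) => //.
by rewrite -[f - _]opprB f0 oppr0 [extz 0]raddf0 sub0r raddfB.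
Qed.

Lemma range_j_fun_D_bd2 (y : wedge_tensor 2 (ob L)) :
  range (@j_fun L H hH 1) (D_bd2 y) <->
  forall i, range incl (one_sub_tvmx i (y ind2)).
Proof.
split=> [[x _ /esym/D_bd2_coordP[]]|E].
  rewrite j_funE [in X in _ -> X -> _]j_funE => E1 E0 i.
  have [->|->] := ord2P i; first by exists (x (ind1 1)).
  by exists (- x (ind1 0)) => //; rewrite raddfN /= -E1 opprK.
have [x1 _ E1] := E 1; have [x0 _ E0] := E 0.
exists (tensor (eps (ind1 1)) x0 - tensor (eps (ind1 0)) x1) => //.
apply/esym/D_bd2_coordP; split.
  rewrite j_funE wedge_tensorB !tensor_eps eqxx (inj_eq ind1_inj) /= sub0r.
  by rewrite raddfN /= E1.
by rewrite j_funE wedge_tensorB !tensor_eps eqxx (inj_eq ind1_inj) /= subr0.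
Qed.

(** * Lifting boundaries to ℤH *)

(** The common reformulation of (ii) and (iii), freed from exterior powers and
    from blocks respectively. *)
Definition boundary_lifting := forall h : {malg int[ob L]},
  (forall i, range incl (one_sub_tvmx i h)) ->
  exists g, forall i, one_sub_tvmx i h = one_sub_tvmx i (incl g).

Lemma boundary_liftingP :
  let j := j_map rfL hH in
  (range (bd (D_complex rfL) 2%N)
     `&` (j 1%N @` [set x | bd (D_complex (row_finite_restr hH rfL)) 1%N x = 0])
     `<=` j 1%N @` range (bd (D_complex (row_finite_restr hH rfL)) 2%N))
  <-> boundary_lifting.
Proof.
move=> j; split=> [sub h hE|lift _ [[y _ <-] [x _ xy]]].
  pose y : wedge_tensor 2 (ob L) := tensor (eps ind2) h.
  have yE : y ind2 = h by rewrite tensor_eps eqxx.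
  have [x _ xy] : range (@j_fun L H hH 1) (D_bd2 y).
    by apply/range_j_fun_D_bd2 => i; rewrite yE.
  (* [j] commutes with the boundaries and is injective in degree 0. *)
  have x0 : D_bd1 x = 0.
    apply: (@j_fun_inj 0); rewrite raddf0.
    by rewrite [LHS](j_fun_bd rfL (a := 1%N) x) xy; apply: D_bd1_bd2.
  have [] := sub (D_bd2 y); first by split; [exists y|exists x].
  move=> _ [w _ <-] /esym; rewrite [RHS](j_fun_bd rfL (a := 2%N) w).
  move=> /D_bd2_eqP; rewrite yE j_funE => E.
  by exists (w ind2).
have [|g gE] := lift (y ind2).
  by apply/range_j_fun_D_bd2; exists x.
pose w : wedge_tensor 2 (ob (restr hH)) := tensor (eps ind2) g.
exists (D_bd2 w); first by exists w.
rewrite [LHS](j_fun_bd rfL (a := 2%N) w); apply/D_bd2_eqP => i.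
by rewrite j_funE tensor_eps eqxx gE.
Qed.

Lemma boundary_lifting_blockP :
  boundary_lifting <->
  forall f : {malg int[K]}, (forall i, tvmx_block i K K f - f = 0) ->
  exists g : {malg int[H]},
    forall i, tvmx_block i K H f = tvmx_block i H H g - g.
Proof.
split=> [lift f f0|lift h hE].
  have [i|g gE] := lift (extz f).
    by apply/range_incl_one_sub_tvmx; rewrite extzK.
  exists g => i; apply: oppr_inj; rewrite opprB tvmx_block_restr.
  apply: incl_inj; rewrite [RHS](incl_one_sub_tvmx rfL) -gE.
  rewrite one_sub_tvmx_extz_setC -[f - _]opprB f0 oppr0 [extz 0]raddf0 sub0r.
  by rewrite raddfN.
have f0 i : tvmx_block i K K (restrz K h) - restrz K h = 0.
  exact/range_incl_one_sub_tvmx.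
(* The part of [h] in ℤH is added back to the solution found outside [H]. *)
have [g gE] := lift _ f0; exists (restrz H h + g) => i.
rewrite {1}(extz_restrzD H h) [LHS]raddfD [incl _]raddfD [RHS]raddfD /=.
congr (_ + _); rewrite one_sub_tvmx_extz_setC -[restrz K h - _]opprB f0 oppr0.
rewrite [extz 0]raddf0 sub0r gE tvmx_block_restr -(incl_one_sub_tvmx rfL).
by rewrite -raddfN /= opprB.
Qed.

End Blocks.

Theorem proposition4p4 (L : two_graph) (neL : inhabited (ob L))
    (rfL : row_finite L) (nsL : no_sources L)
    (H : set (ob L)) (hH : hereditary H) (sH : saturated H) :
  let DL := D_complex rfL in
  let DG := D_complex (row_finite_restr hH rfL) in
  let j := j_map rfL hH in
  let K := ~` H in
  let cond_i := injective (homology_map j 1%N) in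
  let cond_ii :=
    range (bd DL 2%N) `&` (j 1%N @` [set x | bd DG 1%N x = 0])
      `<=` j 1%N @` range (bd DG 2%N) in
  let cond_iii :=
    (fun f : {malg int[K]} => (tvmx_block 0 K H f, tvmx_block 1 K H f)) @`
      ([set f | tvmx_block 0 K K f - f = 0]
       `&` [set f | tvmx_block 1 K K f - f = 0])
      `<=` range (fun g : {malg int[H]} =>
                    (tvmx_block 0 H H g - g, tvmx_block 1 H H g - g)) in
  (cond_i <-> cond_ii) /\ (cond_ii <-> cond_iii).
Proof.
move=> DL DG j K cond_i cond_ii cond_iii.
split; first exact/homology_map_injP/j_fun_inj.
apply: (iff_trans (boundary_liftingP rfL hH)).
apply: (iff_trans (boundary_lifting_blockP rfL hH)).
split=> [lift _ [f [/= f0 f1] <-]|sub f f0].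
  have [i|g gE] := lift f.
    by have [->|->] := ord2P i; [exact: f0|exact: f1].
  by exists g => //; rewrite (gE 0) (gE 1).
have [|g _ [E0 E1]] := sub (tvmx_block 0 K H f, tvmx_block 1 K H f).
  by exists f => //; split; apply: f0.
by exists g => i; have [->|->] := ord2P i; [exact: esym E0|exact: esym E1].
Qed.
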